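(* Let $A_{n,k}(q)$ denote the $q$-Eulerian numbers defined below. For any positive integers $a$ and $b$, $$\sum_{k\geq 0}{\begin{bmatrix} a+b\\ k\end{bmatrix}}_q A_{k,a-1}(q)=\sum_{k\geq 0}{\begin{bmatrix} a+b\\ k\end{bmatrix}}_q A_{k,b-1}(q).$$
   Context: For a positive integer $n$ let $(z;q)_n=\prod_{i=0}^{n-1}(1-zq^i)$, and $(z;q)_0=1$. The $q$-exponential function is $e(z;q)=\sum_{n\geq 0} z^n/(q;q)_n$. The $q$-Eulerian polynomials $A_n(t,q)$ are defined by the generating function $$\sum_{n\geq 0}A_n(t,q)\frac{z^n}{(q;q)_n}=\frac{e(z;q)-e(tz;q)}{e(tz;q)-t\,e(z;q)}$$ (so in particular $A_0(t,q)=0$), and the $q$-Eulerian numbers $A_{n,k}(q)$ are their coefficients: $A_n(t,q)=\sum_{k=0}^n A_{n,k}(q)t^k$, with $A_{n,k}(q)=0$ for $k<0$ or $k>n$. The $q$-binomial coefficient is ${\begin{bmatrix} n\\ k\end{bmatrix}}_q=\frac{(q;q)_n}{(q;q)_{n-k}(q;q)_k}$ for $0\le k\le n$ and $0$ if $k<0$ or $k>n$. *)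

(* Defs.v *)
From HB Require Import structures.
From mathcomp Require Import all_boot all_order all_algebra.

Set Implicit Arguments.
Unset Strict Implicit.
Unset Printing Implicit Defensive.

Import GRing.Theory.
Local Open Scope ring_scope.
Local Open Scope quotient_scope.

Notation "x %:F" := (@FracField.tofrac _ x) : ring_scope.

(* Formal power series in z over F are coefficient sequences nat -> F. *)

Definition fps_mul (R : nzRingType) (f g : nat -> R) (n : nat) : R :=
  \sum_(i < n.+1) f i * g (n - i)%N.

(* The first n coefficients of f / g, by long division. *)
Fixpoint fps_div_prefix (F : fieldType) (f g : nat -> F) (n : nat) : seq F :=
  if n is m.+1 then
    let s := fps_div_prefix f g m in
    rcons s ((f m - \sum_(i < m) s`_i * g (m - i)%N) / g 0%N)
  else [::].

(* The quotient power series f / g, meaningful when g 0 != 0; see fps_divK. *)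
Definition fps_div (F : fieldType) (f g : nat -> F) (n : nat) : F :=
  (fps_div_prefix f g n.+1)`_n.

Definition qpoch (R : comNzRingType) (z q : R) (n : nat) : R :=
  \prod_(i < n) (1 - z * q ^+ i).

Definition qbinom (F : fieldType) (q : F) (n k : nat) : F :=
  if (k <= n)%N then qpoch q q n / (qpoch q q (n - k) * qpoch q q k) else 0.

(* The power series e(w z; q) in z. *)
Definition qexp (F : fieldType) (w q : F) (n : nat) : F :=
  w ^+ n / qpoch q q n.

(* The power series (e(z;q) - e(tz;q)) / (e(tz;q) - t e(z;q)) in z. *)
Definition qEulerian_gf (F : fieldType) (t q : F) : nat -> F :=
  fps_div (fun n => qexp 1 q n - qexp t q n)
          (fun n => qexp t q n - t * qexp 1 q n).

(* The polynomial p such that c = p%:F, when there is one; see polyfracK. *)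
Definition polyfrac (F : fieldType) (c : {fraction {poly F}}) : {poly F} :=
  \n_(repr c) %/ \d_(repr c).

(* A_n(t,q) as a polynomial in t over F: the generating function is a power
   series over F(t), and its n-th coefficient times (q;q)_n lies in F[t]; see
   qEulerian_polyE. *)
Definition qEulerian_poly (F : fieldType) (q : F) (n : nat) : {poly F} :=
  let qt : {fraction {poly F}} := q%:P%:F in
  polyfrac (qEulerian_gf 'X%:F qt n * qpoch qt qt n).

Definition qEulerian (F : fieldType) (q : F) (n k : nat) : F :=
  (qEulerian_poly q n)`_k.

Definition Qq : fieldType := {fraction {poly rat}}.
Definition qvar : Qq := ('X : {poly rat})%:F.

Section Sanity.

Lemma size_fps_div_prefix (F : fieldType) (f g : nat -> F) n :
  size (fps_div_prefix f g n) = n.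
Proof. by elim: n => //= n IHn; rewrite size_rcons IHn. Qed.

Lemma nth_fps_div_prefix (F : fieldType) (f g : nat -> F) n i :
  (i < n)%N -> (fps_div_prefix f g n)`_i = fps_div f g i.
Proof.
elim: n => // n IHn; rewrite ltnS leq_eqVlt => /predU1P[-> //|lt_in].
by rewrite /= nth_rcons size_fps_div_prefix lt_in IHn.
Qed.

Lemma fps_div_rec (F : fieldType) (f g : nat -> F) n :
  fps_div f g n =
    (f n - \sum_(i < n) fps_div f g i * g (n - i)%N) / g 0%N.
Proof.
rewrite {1}/fps_div /= nth_rcons size_fps_div_prefix ltnn eqxx.
by congr ((_ - _) / _); apply: eq_bigr => i _; rewrite nth_fps_div_prefix.
Qed.

Lemma fps_divK (F : fieldType) (f g : nat -> F) n :
  g 0%N != 0 -> fps_mul (fps_div f g) g n = f n.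
Proof.
move=> g0; rewrite /fps_mul big_ord_recr /= subnn fps_div_rec divfK //.
by rewrite addrCA subrr addr0.
Qed.

Lemma polyfracK (F : fieldType) (p : {poly F}) : polyfrac p%:F = p.
Proof.
have /eqP := FracField.equivf_l (Ratio p 1).
rewrite !numden_Ratio ?oner_eq0 // mulr1 -/(FracField.type _).
have -> : \pi_({fraction {poly F}}) (Ratio p 1) = p%:F.
  by rewrite /FracField.tofrac; unlock.
by rewrite /polyfrac => /eqP ->; rewrite mulKp // denom_ratioP.
Qed.

Variables (F : fieldType) (q : F).
Hypothesis q_neq1 : forall n : nat, (0 < n)%N -> q ^+ n != 1.

Local Notation qt := (q%:P%:F : {fraction {poly F}}).
Local Notation t := ('X%:F : {fraction {poly F}}).

Lemma qpoch_neq0 n : qpoch q q n != 0.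
Proof.
rewrite /qpoch; apply/prodf_neq0 => i _.
by rewrite -exprS subr_eq0 eq_sym q_neq1.
Qed.

Lemma qpoch_frac n : qpoch qt qt n = (qpoch q q n)%:P%:F.
Proof.
rewrite /qpoch !rmorph_prod; apply: eq_bigr => i _ /=.
by rewrite -rmorphXn -rmorphM -(rmorph1 (@FracField.tofrac {poly F})) -rmorphB /=
           -polyC_exp -polyCM -polyCB.
Qed.

Lemma qpochV_frac n : (qpoch qt qt n)^-1 = ((qpoch q q n)^-1)%:P%:F.
Proof.
have h : qpoch qt qt n != 0 by rewrite qpoch_frac tofrac_eq0 polyC_eq0 qpoch_neq0.
apply: (mulfI h); rewrite divff // qpoch_frac -!rmorphM /= divff ?qpoch_neq0 //.
Qed.

Lemma fracX_neq1 : 1 - t != 0.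
Proof.
rewrite -(rmorph1 (@FracField.tofrac {poly F})) -rmorphB tofrac_eq0 subr_eq0.
by apply/eqP => /(congr1 (fun p : {poly F} => size p)); rewrite size_poly1 size_polyX.
Qed.

Lemma qexp0 (K : fieldType) (w r : K) : qexp w r 0 = 1.
Proof. by rewrite /qexp /qpoch big_ord0 expr0 divr1. Qed.

Lemma qEulerian_gf_poly n :
  exists2 p : {poly F}, (size p <= n)%N & qEulerian_gf t qt n = p%:F.
Proof.
have sz1 k : (size (\sum_(i < k) 'X^i : {poly F})%R <= k)%N.
  apply: (leq_trans (size_sum _ _ _)); apply/bigmax_leqP => i _.
  by rewrite size_polyXn.
have geo k : (1 - t) * (\sum_(i < k) 'X^i : {poly F})%:F = 1 - t ^+ k.
  rewrite -opprB -[RHS]opprB subrX1 mulNr rmorph_sum /=; congr (- (_ * _)).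
  by apply: eq_bigr => i _; rewrite rmorphXn.
elim/ltn_ind: n => n IHn.
pose P i := polyfrac (qEulerian_gf t qt i).
have Ps i : (i < n)%N -> (size (P i) <= i)%N.
  by move=> /IHn[p sp e]; rewrite /P e polyfracK.
have PE i : (i < n)%N -> qEulerian_gf t qt i = (P i)%:F.
  by move=> /IHn[p sp e]; rewrite /P e polyfracK.
exists ((qpoch q q n)^-1 *: (\sum_(i < n) 'X^i) +
   \sum_(i < n) P i * ((qpoch q q (n - i))^-1 *: ('X * \sum_(j < (n - i).-1) 'X^j))).
  apply: (leq_trans (size_polyD _ _)); rewrite geq_max.
  rewrite (leq_trans (size_scale_leq _ _) (sz1 n)) /=.
  apply: (leq_trans (size_sum _ _ _)); apply/bigmax_leqP => i _.
  apply: (leq_trans (size_polyMleq _ _)).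
  have h : (size ((qpoch q q (n - i))^-1 *: ('X * \sum_(j < (n - i).-1) 'X^j : {poly F}))%R <= n - i)%N.
    apply: (leq_trans (size_scale_leq _ _)); apply: (leq_trans (size_polyMleq _ _)).
    rewrite size_polyX /=; apply: leq_ltn_trans (sz1 _) _.
    by rewrite prednK ?subn_gt0.
  rewrite -subn1 leq_subLR; apply: leq_trans (leq_add (Ps _ (ltn_ord i)) h) _.
  by rewrite subnKC ?leqnSn // ltnW.
apply: (mulfI fracX_neq1).
rewrite /qEulerian_gf fps_div_rec -/(qEulerian_gf t qt) !qexp0 mulr1.
rewrite mulrC divfK ?fracX_neq1 //.
rewrite rmorphD mulrDr rmorph_sum /= mulr_sumr; congr (_ + _).
  by rewrite -mul_polyC rmorphM /= mulrCA geo /qexp -qpochV_frac expr1n -mulrBl mulrC.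
rewrite -sumrN; apply: eq_bigr => i _.
have n_i : (0 < n - i)%N by rewrite subn_gt0.
rewrite -/(qEulerian_gf t qt i) PE // -mul_polyC !rmorphM /= -qpochV_frac.
rewrite [RHS]mulrCA -mulrN; congr (_ * _).
rewrite [RHS]mulrCA [X in _ = _ * X]mulrCA geo /qexp expr1n mulrBr mulr1 -exprS prednK //.
by rewrite mulrA mulr1 -mulrBl -mulNr opprB mulrC.
Qed.

Lemma qEulerian_polyE n :
  (qEulerian_poly q n)%:F / qpoch qt qt n = qEulerian_gf t qt n.
Proof.
have [p _ e] := qEulerian_gf_poly n.
rewrite /qEulerian_poly e {1}qpoch_frac -rmorphM polyfracK rmorphM /= -qpoch_frac.
by rewrite mulfK // qpoch_frac tofrac_eq0 polyC_eq0 qpoch_neq0.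
Qed.

Lemma size_qEulerian_poly n : (size (qEulerian_poly q n) <= n)%N.
Proof.
have [p sp e] := qEulerian_gf_poly n.
rewrite /qEulerian_poly e qpoch_frac -rmorphM polyfracK mulrC mul_polyC.
exact: leq_trans (size_scale_leq _ _) sp.
Qed.

End Sanity.

Lemma qvar_neq1 n : (0 < n)%N -> qvar ^+ n != 1.
Proof.
move=> n0; rewrite /qvar -rmorphXn -(rmorph1 (@FracField.tofrac {poly rat})).
rewrite tofrac_eq; apply/eqP => /(congr1 (fun p : {poly rat} => size p)).
by rewrite size_polyXn size_poly1 => -[] n_0; rewrite n_0 in n0.
Qed.

(* Main.v *)
Require Import Defs.
From mathcomp Require Import all_boot all_order all_algebra.

Import GRing.Theory.
Local Open Scope ring_scope.

(** Clearing denominators in the generating function gives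
    [sum_k [n,k] A_k(t) (t^(n-k) - t) = 1 - t^n].  Both sides change sign under
    [t^j <-> t^(n-j)], so induction on [n] yields the symmetry
    [A_(n,j) = A_(n,n-1-j)].  With this symmetry, the coefficient of [t^a] in
    the same identity for [n = a + b] is the claim. *)

Section QEulerian.

Variables (F : fieldType) (q : F).
Hypothesis q_neq1 : forall n : nat, (0 < n)%N -> q ^+ n != 1.

Local Notation qt := (q%:P%:F : {fraction {poly F}}).
Local Notation P := (qEulerian_poly q).

Lemma qbinomnn n : qbinom q n n = 1.
Proof.
by rewrite /qbinom leqnn subnn {2}/qpoch big_ord0 mul1r divff // qpoch_neq0.
Qed.

Lemma qEulerian_poly_rec n :
  \sum_(k < n.+1) qbinom q n k *: (P k * ('X^(n - k) - 'X)) = 1 - 'X^n.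
Proof.
pose g m := qexp 'X%:F qt m - 'X%:F * qexp 1 qt m.
have g0 : g 0%N != 0 by rewrite /g !qexp0 mulr1 fracX_neq1.
have := fps_divK (fun m => qexp 1 qt m - qexp 'X%:F qt m) n g0.
move/(congr1 ( *%R (qpoch qt qt n))); rewrite /fps_mul mulr_sumr => E.
(* The embedding of [{poly F}] into its fraction field is injective, so the identity can be checked
   there, where the generating function lives. *)
apply/eqP; rewrite -tofrac_eq; apply/eqP; rewrite rmorphB rmorph1 rmorphXn /=.
have nz : qpoch qt qt n != 0 by rewrite qpoch_frac tofrac_eq0 polyC_eq0 qpoch_neq0.
transitivity (qpoch qt qt n * (qexp 1 qt n - qexp 'X%:F qt n)); last first.
  by rewrite /qexp expr1n -mulrBl mulrCA divff // mulr1.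
rewrite -{}E rmorph_sum /=; apply: eq_bigr => k _.
rewrite -/(qEulerian_gf 'X%:F qt k) -qEulerian_polyE //.
rewrite /qbinom -ltnS ltn_ord /g /qexp expr1n -mul_polyC !rmorphM rmorphB /= rmorphXn /=.
rewrite invfM !rmorphM /= -!qpochV_frac // -qpoch_frac mul1r -mulrBl.
by rewrite -mulrA; congr (_ * _); rewrite mulrC [X in _ * X]mulrC mulrACA.
Qed.

(* The coefficient of index [n - j] in ['X * P k] is [A_(k,n-1-j)], read as 0
   when [j = n]. *)
Lemma qEulerian_poly_sym_shift n k j :
    (forall i, (i <= k)%N -> (P k)`_i = ('X * P k)`_(k - i)) ->
  (k <= n)%N -> (j <= n)%N -> ('X^(n - k) * P k)`_j = ('X * P k)`_(n - j).
Proof.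
move=> symk le_kn le_jn; rewrite coefXnM; case: ltnP => h.
  (* Both sides vanish here: [P k] has degree below [k], and [(n - j).-1] is at least [k]. *)
  rewrite coefXM; case: eqP => // _; rewrite nth_default //.
  apply: leq_trans (size_qEulerian_poly q_neq1 k) _.
  have lt_k : (k < n - j)%N by rewrite ltn_subRL addnC -ltn_subRL.
  by rewrite -ltnS prednK // (leq_trans _ lt_k).
rewrite symk; last by rewrite leq_subLR subnK.
by rewrite subnBA // subnKC.
Qed.

(** Strong induction on [n] makes the coefficients of [(1 - 'X) * P n] antisymmetric under
    [j <-> n - j]. They are the differences [A_(n,j) - A_(n,j-1)], so a second induction, on [j],
    recovers the symmetry of [P n] itself. *)
Lemma qEulerian_poly_sym n j : (j <= n)%N -> (P n)`_j = ('X * P n)`_(n - j).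
Proof.
elim/ltn_ind: n j => n IHn.
have anti j : (j <= n)%N ->
    (P n)`_(n - j) - ('X * P n)`_(n - j) = - ((P n)`_j - ('X * P n)`_j).
  (* This isolates the term [k = n] of the recurrence, whose q-binomial is 1. *)
  have E i : (P n)`_i - ('X * P n)`_i = (1 - 'X^n : {poly F})`_i -
      \sum_(k < n) qbinom q n k * (('X^(n - k) * P k)`_i - ('X * P k)`_i).
    rewrite -qEulerian_poly_rec big_ord_recr /= qbinomnn scale1r subnn expr0.
    rewrite coefD coef_sum mulrBr mulr1 coefB [P n * 'X]mulrC.
    set S := (X in _ = X + _ - _); set S' := (X in _ = _ - X).
    suff -> : S = S' by rewrite addrAC subrr add0r.
    apply: eq_bigr => k _.
    by rewrite coefZ mulrBr coefB [P k * 'X^_]mulrC [P k * 'X]mulrC.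
  move=> le_jn; rewrite !E opprB [RHS]addrC -!sumrN; congr (_ + _).
    have -> : (1 - 'X^n : {poly F})`_(n - j) = (j == n)%:R - (j == 0%N)%:R.
      rewrite coefB coef1 coefXn subn_eq0 [(j == n)%N]eqn_leq le_jn.
      by rewrite -{3}(subn0 n) eqn_sub2lE.
    by rewrite coefB coef1 coefXn opprB.
  (* For [k < n], the reflection exchanges the coefficients of ['X^(n - k) * P k] and ['X * P k]. *)
  apply: eq_bigr => k _; rewrite -mulrN opprB; congr (_ * (_ - _)).
    rewrite qEulerian_poly_sym_shift ?(ltnW (ltn_ord k)) //.
    exact: IHn.
  rewrite qEulerian_poly_sym_shift ?subKn ?leq_subr ?(ltnW (ltn_ord k)) //.
  exact: IHn.
elim=> [_|j IHj lt_jn].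
  have := anti 0%N isT; rewrite subn0 [('X * _)`_0]coefXM subr0.
  rewrite [(P n)`_n]nth_default ?(size_qEulerian_poly q_neq1) //.
  by rewrite sub0r => /oppr_inj.
have := anti _ lt_jn; rewrite [('X * _)`_j.+1]coefXM /= IHj ?(ltnW lt_jn) //.
rewrite [('X * _)`_(n - j)]coefXM subn_eq0 leqNgt lt_jn /= -subnS.
by rewrite opprB => /addrI /oppr_inj.
Qed.

Lemma sum_qbinom_qEulerian_sym a b : (0 < a)%N -> (0 < b)%N ->
  \sum_(k < (a + b).+1) qbinom q (a + b) k * qEulerian q k a.-1 =
  \sum_(k < (a + b).+1) qbinom q (a + b) k * qEulerian q k b.-1.
Proof.
move=> a_gt0 b_gt0; apply/esym/eqP; rewrite -subr_eq0 -sumrB; apply/eqP.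
(* As [0 < a < a + b], the coefficient of [t^a] in [1 - t^(a+b)] is 0. *)
have := congr1 (fun p : {poly F} => p`_a) (qEulerian_poly_rec (a + b)).
have /negPf a_neq : (a != a + b)%N
  by rewrite neq_ltn -addn1 leq_add2l b_gt0.
rewrite coefB coef1 coefXn a_neq eqn0Ngt a_gt0 subr0 coef_sum => E.
rewrite -[RHS]E; apply: eq_bigr => k _.
rewrite coefZ mulrBr coefB mulrBr [P k * _]mulrC [P k * 'X]mulrC.
(* By symmetry [t^(a+b-k) A_k] contributes [A_(k,b-1)], while [t A_k] contributes [A_(k,a-1)]. *)
rewrite qEulerian_poly_sym_shift ?leq_addr //; last 2 first.
- exact: qEulerian_poly_sym.
- by rewrite -ltnS.
by rewrite addKn !coefXM !eqn0Ngt a_gt0 b_gt0.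
Qed.

End QEulerian.

Theorem theorem1 (a b : nat) (ha : (0 < a)%N) (hb : (0 < b)%N) :
  \sum_(k < (a + b).+1) qbinom qvar (a + b) k * qEulerian qvar k a.-1 =
  \sum_(k < (a + b).+1) qbinom qvar (a + b) k * qEulerian qvar k b.-1.
Proof. exact: (sum_qbinom_qEulerian_sym _ _ qvar_neq1). Qed.
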